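(* Let $G$ be a bipartite graph with generic completion rank $r$. Then the maximum typical rank of $G$ is at most $2r-1$.
   Context: A bipartite graph $G=(R\cup C,E)$ is finite, with parts $R$ (of size $m$) and $C$ (of size $n$) and edge set $E\subseteq R\times C$. For a field $K$, a $G$-partial matrix over $K$ is a vector $M=(M_{ij})_{(i,j)\in E}\in K^E$. A completion of $M$ over $K$ is an $m\times n$ matrix $A$ with entries in $K$, rows indexed by $R$ and columns indexed by $C$, with $A_{ij}=M_{ij}$ for all $(i,j)\in E$. The $K$-completion rank of $M$ is the smallest rank of a completion of $M$ over $K$; for $K=\mathbb{R}$ (resp. $\mathbb{C}$) it is called the real (resp. complex) completion rank. The generic completion rank of $G$ is the unique integer $r$ that is the complex completion rank of almost all $G$-partial matrices over $\mathbb{C}$, that is, of all $G$-partial matrices in the complement of a certain hypersurface in $\mathbb{C}^E$. An integer $s$ is a typical rank (typical completion rank) of $G$ if the set of $M\in\mathbb{R}^E$ with real completion rank $s$ has nonempty interior in the Euclidean topology. The maximum typical rank of $G$ is the largest integer that is a typical rank of $G$.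
   Formalization: For a graph with no edges (r = 0) the maximum typical rank is 0, so the stated bound 2r−1 = −1 fails; the formal theorem reads the bound as max(2r−1, 0), which changes only this edgeless case. *)

(* Defs.v *)
From HB Require Import structures.
From mathcomp Require Import all_boot all_order all_algebra.
From mathcomp Require Import complex.
From mathcomp Require Import boolp classical_sets reals topology normedtype.
From mathcomp Require Import -(notations) mpoly.

Set Implicit Arguments.
Unset Strict Implicit.
Unset Printing Implicit Defensive.

Import Order.TTheory GRing.Theory Num.Theory.
Import numFieldNormedType.Exports.

Local Open Scope ring_scope.
Local Open Scope classical_set_scope.

(* A bipartite graph with parts 'I_m and 'I_n is its edge set
   E : {set 'I_m * 'I_n}. A vector of K^E is encoded as a row vector of length
   #|E|, whose k-th entry is the one at the edge enum_val k : 'I_m * 'I_n. *)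
Notation partial_matrix K E := 'rV[K]_(#|E|).

Section CompletionRank.
Variables (K : fieldType) (m n : nat) (E : {set 'I_m * 'I_n}).

Definition completion (M : partial_matrix K E) (A : 'M[K]_(m, n)) : Prop :=
  forall k : 'I_#|E|, A (enum_val k).1 (enum_val k).2 = M ord0 k.

Definition completion_rank (M : partial_matrix K E) (r : nat) : Prop :=
  (exists2 A : 'M[K]_(m, n), completion M A & \rank A = r) /\
  (forall A : 'M[K]_(m, n), completion M A -> (r <= \rank A)%N).

End CompletionRank.

Section Ranks.
Variables (R : realType) (m n : nat) (E : {set 'I_m * 'I_n}).

(* The excluded hypersurface is the zero set of p; a nonzero constant p is
   allowed, so that the notion also makes sense for E = set0. *)
Definition generic_completion_rank (r : nat) : Prop :=
  exists2 p : mpoly #|E| R[i], p != 0 &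
    forall M : partial_matrix R[i] E,
      meval (fun k => M ord0 k) p != 0 -> completion_rank M r.

Definition typical_rank (s : nat) : Prop :=
  interior [set M : partial_matrix R E | completion_rank M s] !=set0.

Definition maximum_typical_rank (s : nat) : Prop :=
  typical_rank s /\ (forall t : nat, typical_rank t -> (t <= s)%N).

End Ranks.

(* Main.v *)
Require Import Defs.
From mathcomp Require Import all_boot all_order all_algebra.
From mathcomp Require Import reals.
From mathcomp Require Import complex topology normedtype.
From mathcomp Require Import -(notations) mpoly.
From mathcomp Require Import zify.

(** The bound comes from the sparsity of [E], in two independent halves.

Complex half. A matrix of rank at most [r] is a matrix of inner products: to the
vertices, that is, to the rows and the columns, one attaches vectors in
[K ^ r] whose inner products are the entries. If generic partial matrices have such a
completion, then for every nonempty set [S] of vertices the entries on the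
edges inside [S] are functions of the [r * #|S|] coordinates attached to [S].
One of these coordinates can be normalized to 1, because the products of a row
vector and a column vector do not change when all row vectors are multiplied
by [t] and all column vectors are divided by [t]. So there are fewer than
[r * #|S|] parameters, and since more polynomials than variables are
algebraically dependent ([algebraic_dependence]), [S] spans fewer than
[r * #|S|] edges as soon as it spans one ([gram_dependence]). Summing degrees
([handshake]), some vertex of [S] has at most [2 * r - 1] neighbours in [S]: the
graph is [(2 * r - 1)]-degenerate ([generic_rank_degenerate]).

Real half. On a [k]-degenerate graph all real weights are approximated by inner
products of vectors of [F ^ k] ([degenerate_approximation]). When the vertices
are added one at a time, each with at most [k] neighbours among the earlier
ones, the vector of a new vertex has to satisfy at most [k] linear equations.
These are independent as long as the earlier vectors are in general position,
and a small move along the moment curve puts the new vector in general position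
as well.

Hence an open set of real partial matrices always contains one that has a
completion of rank at most [k = 2 * r - 1], which bounds every typical rank. *)

Set Implicit Arguments.
Unset Strict Implicit.
Unset Printing Implicit Defensive.

Import Order.TTheory GRing.Theory Num.Theory.
Import numFieldNormedType.Exports.

Local Open Scope ring_scope.

(** * Algebraic dependence and zeros of multivariate polynomials *)

Lemma left_kernel_nonzero (K : fieldType) (a b : nat) (A : 'M[K]_(a, b)) :
  (b < a)%N -> exists2 c : 'rV[K]_a, c != 0 & c *m A = 0.
Proof.
move=> ltba; exists (nz_row (kermx A)); last first.
  by apply/sub_kermxP/nz_row_sub.
rewrite nz_row_eq0 -mxrank_eq0 mxrank_ker subn_eq0 -ltnNge.
exact: leq_ltn_trans (rank_leq_col A) ltba.
Qed.

Lemma msize_prod_exp_le (K : fieldType) (e N d k : nat)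
    (f : 'I_e -> mpoly N K) (h : 'I_e -> nat) :
  (forall i, (msize (f i) <= d.+1)%N) -> (forall i, (h i <= k)%N) ->
  (msize (\prod_(i < e) f i ^+ h i) <= (e * (k * d)).+1)%N.
Proof.
move=> fd hk.
have msizeM_succ a b (p q : mpoly N K) :
    (msize p <= a.+1 -> msize q <= b.+1 -> msize (p * q) <= (a + b).+1)%N.
  move=> pa qb; have [->|p0] := eqVneq p 0; first by rewrite mul0r msize0.
  have [->|q0] := eqVneq q 0; first by rewrite mulr0 msize0.
  by rewrite msizeM //; move: (msize p) (msize q) pa qb; lia.
have msizeX_succ (p : mpoly N K) j : (msize p <= d.+1 -> msize (p ^+ j) <= (j * d).+1)%N.
  move=> pd; elim: j => [|j IH]; first by rewrite expr0 msize1.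
  by rewrite exprS mulSn msizeM_succ.
have msize_prod j : (j <= e)%N ->
    (msize (\prod_(i < e | (i < j)%N) f i ^+ h i) <= (j * (k * d)).+1)%N.
  elim: j => [|j IH] je; first by rewrite big_pred0 // msize1.
  rewrite (bigD1 (Ordinal je)) //= mulSn; apply: msizeM_succ.
    by rewrite (leq_trans (msizeX_succ _ _ (fd _))) // ltnS leq_mul2r hk orbT.
  rewrite (eq_bigl (fun i : 'I_e => (i < j)%N)) ?IH 1?ltnW //.
  by move=> i; rewrite ltnS ltn_neqAle -val_eqE andbC.
have := msize_prod e (leqnn e); rewrite (eq_bigl xpredT) // => i.
by rewrite ltn_ord.
Qed.

(** Boxes of exponents rather than simplices, so that the numbers of monomials
compared in the dependence argument are plain powers. *)
Definition monom (N D : nat) (s : {ffun 'I_N -> 'I_D}) : multinom N :=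
  Multinom [tuple (s i : nat) | i < N].

Lemma monomE N D (s : {ffun 'I_N -> 'I_D}) i : monom s i = s i.
Proof. exact: mnmE. Qed.

Lemma monom_inj N D : injective (@monom N D).
Proof.
by move=> s t /mnmP st; apply/ffunP => i; apply/val_inj; rewrite /= -!monomE st.
Qed.

Lemma monom_onto N D (m : multinom N) :
  (mdeg m < D)%N -> exists s : {ffun 'I_N -> 'I_D}, m = monom s.
Proof.
move=> mD; have miD i : (m i < D)%N.
  by apply: leq_ltn_trans mD; rewrite mdegE (bigD1 i) //= leq_addr.
by exists [ffun i => Ordinal (miD i)]; apply/mnmP => i; rewrite monomE ffunE.
Qed.

(** A count of monomials. The products of the [f i] with exponents at most [k]
are [k.+1 ^ e] in number, while their degrees are at most [e * (k * d)], so they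
lie in a space whose dimension grows only like [k ^ N]. For large [k] they are
therefore linearly dependent, and a linear dependence between monomials in the
[f i] is the polynomial [q]. *)
Lemma algebraic_dependence (K : fieldType) (e N : nat)
    (f : 'I_e -> mpoly N K) :
  (N < e)%N ->
  exists2 q : mpoly e K, q != 0 &
    forall z : 'I_N -> K, meval (fun i => meval z (f i)) q = 0.
Proof.
move=> ltNe; pose d := \max_(i < e) msize (f i).
have fd i : (msize (f i) <= d.+1)%N.
  by apply: leqW; rewrite /d (bigD1 i) //= leq_maxl.
(* Since e * k * d < (e * d).+1 * k.+1, it suffices that (e * d).+1 ^ N < k.+1. *)
pose k := ((e * d).+1 ^ N)%N; pose D := (e * (k * d)).+1.
pose P (h : {ffun 'I_e -> 'I_k.+1}) := \prod_(i < e) f i ^+ h i.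
have PD h : (msize (P h) <= D)%N.
  by apply: msize_prod_exp_le fd _ => i; rewrite -ltnS.
pose coefs := \matrix_(i < #|{ffun 'I_e -> 'I_k.+1}|,
  j < #|{ffun 'I_N -> 'I_D}|) mcoeff (monom (enum_val j)) (P (enum_val i)).
have [|c c0 cP] := @left_kernel_nonzero _ _ _ coefs.
  rewrite !card_ffun !card_ord.
  apply: (@leq_ltn_trans (((e * d).+1 * k.+1) ^ N)%N).
    have [->|N0] := posnP N; first by rewrite !expn0.
    by rewrite leq_exp2r // /D; nia.
  rewrite expnMn -/k; apply: (@leq_trans (k.+1 ^ N.+1)%N).
    by rewrite expnS ltn_pmul2r ?expn_gt0.
  by rewrite leq_exp2l //; rewrite /k; have := expn_gt0 (e * d).+1 N; lia.
pose cf h := c 0 (enum_rank h).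
have sumP : \sum_h cf h *: P h = 0.
  apply/mpolyP => m; rewrite mcoeff0 raddf_sum /=.
  have [mD|Dm] := ltnP (mdeg m) D; last first.
    rewrite big1 // => h _; rewrite mcoeffZ memN_msupp_eq0 ?mulr0 //.
    by apply: msize_mdeg_ge; apply: leq_trans Dm.
  have [s ->] := monom_onto mD.
  have /rowP/(_ (enum_rank s)) := cP; rewrite !mxE => cPs; rewrite -[RHS]cPs.
  rewrite (reindex _ (onW_bij _ (enum_val_bij _))) /=.
  by apply: eq_bigr => i _; rewrite mcoeffZ /cf enum_valK mxE enum_rankK.
exists (\sum_h cf h *: mpolyX K (monom h)).
  have /eqP/rowP c0' := c0; apply/eqP => q0; apply: c0' => i.
  have := congr1 (mcoeff (monom (enum_val i))) q0.
  rewrite mcoeff0 raddf_sum (bigD1 (enum_val i)) //= big1 => [|h hi].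
    by rewrite addr0 mcoeffZ mcoeffX eqxx mulr1 /cf enum_valK mxE.
  by rewrite mcoeffZ mcoeffX (inj_eq (@monom_inj _ _)) (negPf hi) mulr0.
move=> z; transitivity (meval z (\sum_h cf h *: P h)); last first.
  by rewrite sumP meval0.
rewrite !raddf_sum /=.
apply: eq_bigr => h _; rewrite !mevalZ mevalX /P rmorph_prod /=.
congr (_ * _); apply: eq_bigr => i _; rewrite monomE.
by rewrite rmorphXn.
Qed.

(** Uniqueness of base-[b] digits, the reason why Kronecker's substitution below
keeps distinct monomials apart. *)
Lemma kronecker_inj (N b : nat) (m m' : 'I_N -> nat) :
  (forall i, m i < b)%N -> (forall i, m' i < b)%N ->
  (\sum_(i < N) m i * b ^ i = \sum_(i < N) m' i * b ^ i)%N -> m =1 m'.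
Proof.
elim: N m m' => [|N IH] m m' mb m'b; first by move=> _ [].
rewrite !big_ord_recl /= !expn0 !muln1.
have shift (x : 'I_N.+1 -> nat) : (\sum_(i < N) x (lift ord0 i) * b ^ bump 0 i =
    (\sum_(i < N) x (lift ord0 i) * b ^ i) * b)%N.
  by rewrite big_distrl; apply: eq_bigr => i _; rewrite /= /bump expnD expn1 mulnA mulnAC.
rewrite !shift => E.
have b0 : (0 < b)%N by apply: leq_ltn_trans (mb ord0).
have E0 : m ord0 = m' ord0.
  by move/(congr1 (modn^~ b)): E; rewrite !(addnC _ (_ * b)%N) !modnMDl !modn_small.
move: E; rewrite E0 => /addnI/eqP; rewrite eqn_pmul2r // => /eqP E i.
have [j ->|->] := unliftP ord0 i; last exact: E0.
by apply: (IH (m \o lift ord0) (m' \o lift ord0)) => // k; rewrite /=.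
Qed.

Lemma poly_nonroot_small (F : numFieldType) (p : {poly F}) (d : F) :
  p != 0 -> 0 < d -> exists2 t, 0 < t < d & p.[t] != 0.
Proof.
move=> p0 d0; pose x i : F := d / i.+2%:R.
have xP i : 0 < x i < d.
  rewrite divr_gt0 ?ltr0n //= ltr_pdivrMr ?ltr0n // ltr_pMr //.
  by rewrite ltr1n.
have x_inj : injective x.
  move=> i j /(mulfI (lt0r_neq0 d0))/invr_inj/eqP.
  by rewrite eqr_nat => /eqP [].
have /allPn[_ /mapP[i _ ->] ni] : ~~ all (root p) (map x (iota 0 (size p))).
  apply/negP => /(max_poly_roots p0); rewrite map_inj_uniq ?iota_uniq //.
  by rewrite size_map size_iota ltnn => /(_ isT).
by exists (x i).
Qed.

(** Kronecker's substitution ['X_i := t ^ (b ^ i)], with [b] above all exponents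
of [q], turns [q] into a nonzero polynomial in the single variable [t]. *)
Lemma meval_nonzero (F : numFieldType) (N : nat) (q : mpoly N F) :
  q != 0 -> exists z : 'I_N -> F, meval z q != 0.
Proof.
move=> q0; pose b := msize q.
pose w (m : multinom N) := (\sum_(i < N) m i * b ^ i)%N.
pose p : {poly F} := \sum_(m <- msupp q) mcoeff m q *: 'X^(w m).
have lt_b m i : m \in msupp q -> (m i < b)%N.
  move=> mq; apply: leq_ltn_trans (msize_mdeg_lt mq).
  by rewrite mdegE (bigD1 i) //= leq_addr.
have p0 : p != 0.
  have m0q := mlead_supp q0; set m0 := mlead q in m0q.
  apply/eqP => /(congr1 (fun u : {poly F} => u`_(w m0))); rewrite coef0 coef_sum.
  rewrite (bigD1_seq m0) ?msupp_uniq //= coefZ coefXn eqxx mulr1 big_seq_cond.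
  rewrite big1 ?addr0 => [/eqP|m /andP[mq ne]].
    by rewrite mcoeff_eq0 m0q.
  rewrite coefZ coefXn; case: eqP => [E|]; last by rewrite mulr0.
  case/eqP: ne; apply/mnmP; apply: (@kronecker_inj N b) => // i; exact: lt_b.
have [t _ pt] := poly_nonroot_small p0 ltr01.
exists (fun i => t ^+ (b ^ i)%N); apply: contraNneq pt => qt.
rewrite /root -qt mevalE horner_sum; apply/eqP/eq_bigr => m _.
rewrite hornerZ hornerXn /w expr_sum; congr (_ * _).
by apply: eq_bigr => i _; rewrite mulnC exprM.
Qed.

(** * Inner products of vectors in general position *)

Section GeneralPosition.
Variables (F : realFieldType) (k : nat).

(** The powers start at 1, so that the curve passes through the origin at
[t = 0] and small parameters give small perturbations. *)
Definition moment (t : F) : 'rV[F]_k := \row_j t ^+ j.+1.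

(** A proper subspace lies in a hyperplane with normal vector [h], and on the
translated moment curve the equation of this hyperplane is a polynomial in [t]
with coefficients [h l] in degrees [l.+1], hence a nonzero one. *)
Lemma moment_leaves_subspace (a : nat) (y : 'rV[F]_k) (W : 'M[F]_(a, k)) :
  (\rank W < k)%N ->
  exists2 q : {poly F}, q != 0 &
    forall t, ((y + moment t)%R <= W)%MS -> q.[t] = 0.
Proof.
move=> rkW; have /matrix0Pn[i [j nz]] : cokermx W != 0.
  by rewrite -mxrank_eq0 mxrank_coker subn_eq0 -ltnNge.
pose q := ((y *m cokermx W) 0 j)%:P + \sum_l cokermx W l j *: 'X^(l.+1).
exists q.
  apply: contraNneq nz => q0; have := congr1 (fun u : {poly F} => u`_i.+1) q0.
  rewrite coef0 coefD coefC add0r coef_sum (bigD1 i) //= coefZ coefXn eqxx.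
  rewrite mulr1 big1 ?addr0 => [->//|l li].
  by rewrite coefZ coefXn eqSS eq_sym (inj_eq val_inj) (negPf li) mulr0.
move=> t; rewrite submxE => /eqP/rowP/(_ j).
rewrite mulmxDl !mxE => <-; rewrite /q hornerD hornerC mxE; congr (_ + _).
rewrite horner_sum; apply: eq_bigr => l _.
by rewrite hornerZ hornerXn !mxE mulrC.
Qed.

Lemma moment_avoids_subspaces (I : finType) (P : pred I) (a : I -> nat)
    (W : forall i, 'M[F]_(a i, k)) (y : 'rV[F]_k) (d : F) :
  (forall i, P i -> (\rank (W i) < k)%N) -> 0 < d ->
  exists2 t, 0 < t < d &
    forall i, P i -> ~~ ((y + moment t)%R <= W i)%MS.
Proof.
move=> rkW d0.
have /fin_all_exists2[q q0 qW] : forall i, exists2 q : {poly F}, q != 0 &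
    forall t, P i -> ((y + moment t)%R <= W i)%MS -> q.[t] = 0.
  move=> i; have [Pi|nPi] := boolP (P i); last first.
    by exists 1; rewrite ?oner_eq0.
  have [q q0 qW] := moment_leaves_subspace y (rkW i Pi).
  by exists q => // t _; apply: qW.
have [|t td qt] := @poly_nonroot_small _ (\prod_i q i) d _ d0.
  by rewrite prodf_seq_neq0; apply/allP => i _; rewrite q0.
exists t => // i Pi; apply: contra_neqN qt => /(qW i t Pi) qit.
by rewrite horner_prod (bigD1 i) //= qit mul0r.
Qed.

Variable V : finType.
Implicit Types (p : V -> 'rV[F]_k) (S T : {set V}).

Definition rows_of p T : 'M[F]_(#|T|, k) := \matrix_(i < #|T|) p (enum_val i).

Lemma rows_of_sub p T v : v \in T -> (p v <= rows_of p T)%MS.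
Proof.
move=> vT; have := row_sub (enum_rank_in vT v) (rows_of p T).
by rewrite rowK enum_rankK_in.
Qed.

Lemma eq_rows_of p p' T : {in T, p =1 p'} -> rows_of p T = rows_of p' T.
Proof. by move=> pp'; apply/row_matrixP => i; rewrite !rowK pp' ?enum_valP. Qed.

Lemma row_free_rows_ofU p T v :
  v \in T -> row_free (rows_of p (T :\ v)) ->
  ~~ (p v <= rows_of p (T :\ v))%MS -> row_free (rows_of p T).
Proof.
move=> vT /eqP fr pv; rewrite /row_free eqn_leq rank_leq_row /=.
rewrite [X in (X <= _)%N](cardsD1 v) vT add1n -[X in (X < _)%N]fr.
apply: rank_ltmx; rewrite ltmxE; apply/andP; split.
  apply/row_subP => i; rewrite rowK rows_of_sub //.
  by have := enum_valP i; rewrite !inE => /andP[].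
by apply: contra pv; apply: submx_trans (rows_of_sub p vT).
Qed.

(** Row freeness concerns the family indexed by [T], so that equal vectors at
two vertices of [T] count as dependent. *)
Definition general_position p S :=
  forall T, T \subset S -> (#|T| <= k)%N -> row_free (rows_of p T).

Definition dot (x y : 'rV[F]_k) : F := (x *m y^T) 0 0.

Lemma dotE x y : dot x y = \sum_j x 0 j * y 0 j.
Proof. by rewrite /dot mxE; apply: eq_bigr => j _; rewrite mxE. Qed.

Lemma dotC x y : dot x y = dot y x.
Proof. by rewrite !dotE; apply: eq_bigr => j _; rewrite mulrC. Qed.

Lemma dot_solve p T (c : V -> F) :
  row_free (rows_of p T) ->
  exists y, forall u, u \in T -> dot (p u) y = c u.
Proof.
move=> fr; pose b := \col_(i < #|T|) c (enum_val i).
exists (pinvmx (rows_of p T) *m b)^T => u uT.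
have -> : p u = row (enum_rank_in uT u) (rows_of p T).
  by rewrite rowK enum_rankK_in.
rewrite /dot trmxK -row_mul mulmxA mulmxVp // mul1mx !mxE.
by rewrite enum_rankK_in.
Qed.

Lemma dot_moment_small (X : seq 'rV[F]_k) (eps : F) : 0 < eps ->
  exists2 d, 0 < d &
    forall t, 0 < t < d -> {in X, forall x, `|dot x (moment t)| < eps}.
Proof.
move=> eps0; pose B := \sum_(x <- X) \sum_j `|x 0 j|.
have B0 : 0 <= B by apply: sumr_ge0 => x _; apply: sumr_ge0.
exists (Num.min 1 (eps / (B + 1))).
  by rewrite lt_min ltr01 divr_gt0 // ltr_wpDl.
move=> t /andP[t0]; rewrite lt_min ltr_pdivlMr ?ltr_wpDl // => /andP[t1 tB] x xX.
apply: le_lt_trans tB; apply: (@le_trans _ _ (t * B)); last first.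
  by rewrite ler_wpM2l ?(ltW t0) // lerDl.
rewrite dotE; apply: le_trans (ler_norm_sum _ _ _) _.
apply: (@le_trans _ _ (t * \sum_j `|x 0 j|)).
  rewrite mulr_sumr; apply: ler_sum => j _; rewrite mxE normrM mulrC.
  rewrite ler_wpM2r // ger0_norm ?exprn_ge0 ?(ltW t0) // exprS.
  by rewrite ler_piMr ?(ltW t0) // exprn_ile1 ?(ltW t0) ?(ltW t1).
rewrite ler_wpM2l ?(ltW t0) // /B (big_rem x) //= lerDl.
by apply: sumr_ge0 => z _; apply: sumr_ge0.
Qed.

Definition nbrs (adj : rel V) S v := [set u in S | adj v u].

(** The induction removes a vertex [v] of small degree in [S]. General position
of the other vectors makes the equations for the vector at [v] solvable; the
solution is then moved off the finitely many subspaces spanned by fewer than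
[k] other vectors. This spoils the equations by less than [eps], and is
exactly what keeps the vectors in general position. *)
Lemma degenerate_approximation (adj : rel V) (w : V -> V -> F) (eps : F) :
  ssrbool.symmetric adj -> irreflexive adj -> (forall u v, w u v = w v u) -> 0 < eps ->
  (forall S, S != set0 -> exists2 v, v \in S & (#|nbrs adj S v| <= k)%N) ->
  exists p, forall u v, adj u v -> `|dot (p u) (p v) - w u v| < eps.
Proof.
move=> adjC adjI wC eps0 degen.
suff main S : exists2 p, general_position p S & {in S &, forall u v,
    adj u v -> `|dot (p u) (p v) - w u v| < eps}.
  have [p _ pS] := main setT; exists p => u v; exact: pS.
have [c] := ubnP #|S|; elim: c => // c IH in S *; rewrite ltnS => Sc.
have [->|S0] := eqVneq S set0.
  exists (fun=> 0) => [T|u v]; last by rewrite inE.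
  rewrite subset0 => /eqP -> _.
  by rewrite /row_free eqn_leq rank_leq_row; apply: (@leq_trans 0); rewrite ?cards0.
have [v vS degv] := degen S S0.
have [|p gp pS] := IH (S :\ v); first by rewrite (cardsD1 v S) vS in Sc.
pose N := nbrs adj S v.
have NS : N \subset S :\ v.
  apply/subsetP => u; rewrite !inE => /andP[-> vu]; rewrite andbT.
  by apply: contraTneq vu => ->; rewrite adjI.
have [y0 y0P] := dot_solve (w v) (gp N NS degv).
have [d d0 dP] := dot_moment_small [seq p u | u in N] eps0.
have [T|t td avoid] := @moment_avoids_subspaces {set V}
    (fun T => (T \subset S :\ v) && (#|T| < k)%N) _ (rows_of p) y0 d _ d0.
  by case/andP=> _; apply: leq_ltn_trans (rank_leq_row _).
pose y := y0 + moment t; pose p' u := if u == v then y else p u.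
have p'v : p' v = y by rewrite /p' eqxx.
have p'E u : u != v -> p' u = p u by rewrite /p' => /negPf ->.
have near u : u \in S -> u != v -> adj v u -> `|dot (p' v) (p' u) - w v u| < eps.
  move=> uS uv vu; have uN : u \in N by rewrite !inE uS.
  rewrite p'v p'E // dotC /dot linearD mulmxDr mxE -/(dot _ _) y0P //.
  by rewrite addrAC subrr add0r dP // map_f // mem_enum.
exists p'.
  move=> T TS Tk; have [vT|vT] := boolP (v \in T); last first.
    rewrite (@eq_rows_of p' p) => [|u uT].
      by apply: gp => //; rewrite subsetD1 TS.
    by apply: p'E; apply: contraNneq vT => <-.
  have T'S : T :\ v \subset S :\ v by apply: setSD.
  have rowsE : rows_of p' (T :\ v) = rows_of p (T :\ v).
    by apply: eq_rows_of => u; rewrite !inE => /andP[/p'E].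
  have T'k : (#|T :\ v| < k)%N by rewrite (cardsD1 v T) vT in Tk.
  apply: (row_free_rows_ofU vT); rewrite rowsE; first by apply: gp => //; apply: ltnW.
  by rewrite p'v; apply: avoid; rewrite T'S.
move=> u u' uS u'S uu'; have [E|uv] := eqVneq u v.
  rewrite {}E in uu' *; apply: near => //.
  by apply: contraTneq uu' => ->; rewrite adjI.
have [E|u'v] := eqVneq u' v.
  rewrite {}E in uu' *; rewrite dotC wC; apply: near => //.
  by rewrite adjC.
by rewrite !p'E //; apply: pS => //; rewrite !inE ?uv ?u'v.
Qed.

End GeneralPosition.

(** * Sparsity of graphs of given generic completion rank *)

Section GenericRank.
Variables (m n : nat) (E : {set 'I_m * 'I_n}).
Local Notation vertex := ('I_m + 'I_n)%type.
Implicit Type S : {set vertex}.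

Definition edge_rel : rel vertex := fun u v =>
  match u, v with
  | inl i, inr j | inr j, inl i => (i, j) \in E
  | _, _ => false
  end.

Lemma edge_relC : ssrbool.symmetric edge_rel.
Proof. by move=> [i|j] [i'|j']. Qed.

Lemma edge_relI : irreflexive edge_rel.
Proof. by case. Qed.

Definition edges_in S := [set x in E | (inl x.1 \in S) && (inr x.2 \in S)].

(** The double count of the incident pairs of a vertex and an edge inside [S]:
the rows contribute each edge once, and so do the columns. *)
Lemma handshake S :
  (\sum_(v in S) #|nbrs edge_rel S v| = 2 * #|edges_in S|)%N.
Proof.
pose a i j : nat := (i, j) \in edges_in S.
have sumE : (\sum_i \sum_j a i j = #|edges_in S|)%N.
  rewrite pair_bigA /= -sum1_card [RHS]big_mkcond /=.
  by apply: eq_bigr => -[i j] _; rewrite /a /=; case: ifP.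
have nbrsE : (\sum_(v in S) #|nbrs edge_rel S v| =
    \sum_(v : vertex) \sum_(u : vertex)
      [&& v \in S, u \in S & edge_rel v u])%N.
  rewrite big_mkcond; apply: eq_bigr => v _.
  case: ifP => vS; last by rewrite big1.
  rewrite -sum1_card big_mkcond; apply: eq_bigr => u _.
  by rewrite inE; case: (_ && _).
rewrite nbrsE big_sumType /= mul2n -addnn -{1}sumE -sumE; congr addn.
  apply: eq_bigr => i _; rewrite big_sumType /= big1 => [|i' _].
    rewrite add0n; apply: eq_bigr => j _.
    by rewrite /a inE /=; do 3!case: (_ \in _).
  by rewrite !andbF.
rewrite [RHS]exchange_big; apply: eq_bigr => j _.
rewrite big_sumType /= [X in (_ + X)%N]big1 => [|j' _]; last by rewrite !andbF.
rewrite addn0; apply: eq_bigr => i _.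
by rewrite /a inE /=; do 3!case: (_ \in _).
Qed.

Lemma card_free_edges S :
  #|[set c : 'I_#|E| | enum_val c \notin edges_in S]| = (#|E| - #|edges_in S|)%N.
Proof.
have -> : [set c : 'I_#|E| | enum_val c \notin edges_in S] =
    ~: [set c : 'I_#|E| | enum_val c \in edges_in S].
  by apply/setP => c; rewrite !inE.
rewrite cardsCs setCK card_ord; congr (_ - _)%N.
rewrite -(card_imset _ (@enum_val_inj _ E)); apply: eq_card => x.
apply/imsetP/idP => [[c + ->]|xS]; first by rewrite inE.
have xE : x \in E by move: xS; rewrite inE => /andP[].
have cE := enum_rankK_in xE xE; exists (enum_rank_in xE x) => //.
by rewrite inE cE.
Qed.

(** The entries of a Gram matrix on the edges inside [S] depend on [r * #|S|]
coordinates. The hypothesis [p (inr j0) l0 != 0] permits the rescaling that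
makes this coordinate 1, so that one parameter is saved. The entries on the
remaining edges are taken as further parameters, one each; the total stays
below [#|E|] and the [#|E|] entries are algebraically dependent. *)
Lemma gram_dependence (K : fieldType) (S : {set vertex}) (r : nat)
    (j0 : 'I_n) (l0 : 'I_r) :
  inr j0 \in S -> (r * #|S| <= #|edges_in S|)%N ->
  exists2 q : mpoly #|E| K, q != 0 &
    forall (p : vertex -> 'I_r -> K) (M : 'I_#|E| -> K), p (inr j0) l0 != 0 ->
      (forall c, M c = \sum_l p (inl (enum_val c).1) l *
                              p (inr (enum_val c).2) l) ->
      meval M q = 0.
Proof.
move=> j0S dense.
(* The parameters: Z1 is the set of coordinates attached to S without the
   normalized one, Z2 the set of edges not inside S. *)
pose Z1 := setX S [set: 'I_r] :\ (inr j0, l0).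
pose Z2 := [set c : 'I_#|E| | enum_val c \notin edges_in S].
pose Z : {set (vertex * 'I_r) + 'I_#|E|} := (inl @: Z1) :|: (inr @: Z2).
have cardZ : (#|Z| < #|E|)%N.
  apply: leq_ltn_trans (leq_card_setU _ _) _.
  rewrite !card_imset; [|by move=> ? ? []..].
  have : (#|Z1|.+1 = r * #|S|)%N.
    have := cardsD1 (inr j0, l0) (setX S [set: 'I_r]).
    by rewrite cardsX cardsT card_ord in_setX j0S inE add1n mulnC => ->.
  have : (#|edges_in S| <= #|E|)%N.
    by apply: subset_leq_card; apply/subsetP => x; rewrite inE => /andP[].
  rewrite /Z2 card_free_edges; move: dense.
  move: #|Z1| #|edges_in S| #|E| (r * #|S|)%N => *; lia.
pose X z : mpoly #|Z| K :=
  if z \in Z then \sum_(i < #|Z| | enum_val i == z) mpolyX K (mnm1 i) else 1.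
pose f c := let x := enum_val c in
  if x \in edges_in S then \sum_l X (inl (inl x.1, l)) * X (inl (inr x.2, l))
  else X (inr c).
have [q q0 qf] := algebraic_dependence f cardZ.
exists q => // p M p0 Mp.
(* The values of the parameters after the rescaling by t. *)
pose t := p (inr j0) l0.
pose a z := match z with
  | inl (inl i, l) => p (inl i) l * t
  | inl (inr j, l) => p (inr j) l / t
  | inr c => M c
  end.
have aX z : z \in Z -> meval (fun i : 'I_#|Z| => a (enum_val i)) (X z) = a z.
  move=> zZ; rewrite /X zZ raddf_sum (big_pred1 (enum_rank_in zZ z)) => [|i] /=.
    by rewrite mevalXU enum_rankK_in.
  apply/eqP/eqP => [iz|->]; last by rewrite enum_rankK_in.
  by apply: enum_val_inj; rewrite iz enum_rankK_in.
have aXS v l : v \in S ->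
    meval (fun i : 'I_#|Z| => a (enum_val i)) (X (inl (v, l))) = a (inl (v, l)).
  move=> vS; have [vl|vl] := eqVneq (v, l) (inr j0, l0); last first.
    by apply: aX; rewrite inE imset_f // !inE vl vS.
  rewrite /X vl /= divff // ifN ?meval1 // inE negb_or; apply/andP; split.
    by apply/imsetP => -[z zZ1 [zE]]; rewrite -zE !inE eqxx in zZ1.
  by apply/imsetP => -[].
rewrite -(qf (fun i => a (enum_val i))); apply: meval_eq => c.
rewrite /f; case: ifPn => cS; last by rewrite aX // inE imset_f ?orbT // inE.
rewrite Mp raddf_sum /=; apply: eq_bigr => l _; rewrite mevalM !aXS /=.
- by rewrite mulrACA divff ?mulr1.
- by move: cS; rewrite inE => /and3P[].
- by move: cS; rewrite inE => /and3P[].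
Qed.

(** If all degrees inside [S] exceed [2 * r - 1], then [handshake] gives at
least [r * #|S|] edges. The product of the polynomials of [gram_dependence]
for the [r] possible choices of [l0] then vanishes at every partial matrix with
a completion of rank [r] and a nonzero entry at one fixed edge [x0], but a
generic partial matrix is of this kind. *)
Lemma generic_rank_degenerate (R : realType) (r : nat) :
  generic_completion_rank R E r ->
  forall S, S != set0 ->
    exists2 v, v \in S & (#|nbrs edge_rel S v| <= 2 * r - 1)%N.
Proof.
move=> [g g0 gP] S S0; apply/exists_inP; apply: contraT.
rewrite negb_exists_in => /forall_inP deg.
have dense : (r * #|S| <= #|edges_in S|)%N.
  suff : (2 * (r * #|S|) <= 2 * #|edges_in S|)%N by rewrite leq_mul2l.
  rewrite -handshake mulnA mulnC -sum_nat_const; apply: leq_sum => v vS.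
  by have := deg v vS; rewrite -ltnNge; lia.
(* The truncated difference 2 * r - 1 is a natural number, so the degrees are
   positive, even for r = 0. *)
have [x0 x0S] : exists x, x \in edges_in S.
  apply/set0Pn; rewrite -card_gt0; have [v vS] := set0Pn _ S0.
  have : (0 < 2 * #|edges_in S|)%N; last by rewrite muln_gt0.
  rewrite -handshake (bigD1 v) //= addn_gt0.
  rewrite (leq_ltn_trans _ (_ : 2 * r - 1 < _)%N) //.
  by rewrite ltnNge deg.
have [x0E _ j0S] : [/\ x0 \in E, inl x0.1 \in S & inr x0.2 \in S].
  by move: x0S; rewrite inE => /and3P[].
pose c0 := enum_rank_in x0E x0.
have /fin_all_exists2[q q0 qP] := fun l => @gram_dependence R[i] S r _ l j0S dense.
have [|z] := @meval_nonzero _ _ (g * mpolyX _ (mnm1 c0) * \prod_l q l).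
  rewrite !mulf_neq0 //; last by rewrite prodf_seq_neq0; apply/allP => l _; rewrite q0.
  by apply: contra_eq_neq (msizeX R[i] (mnm1 c0)) => ->; rewrite msize0.
rewrite !mevalM mevalXU !mulf_eq0 !negb_or => /andP[/andP[gz z0] qz].
pose M : partial_matrix R[i] E := \row_c z c.
have [|[A AM rkA] _] := gP M; first by rewrite (@meval_eq _ _ _ z) // => c; rewrite mxE.
have [X [Y AXY]] : exists X : 'M_(m, r), exists Y : 'M_(r, n), A = X *m Y.
  by rewrite -rkA; exists (col_base A), (row_base A); rewrite mulmx_base.
have zE c : z c = \sum_l X (enum_val c).1 l * Y l (enum_val c).2.
  by have := AM c; rewrite AXY !mxE.
(* The entry at x0 is a sum of products with the factors Y l x0.2 and is
   nonzero, so the dependence for one of the indices l applies. *)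
have [l Yl] : exists l, Y l x0.2 != 0.
  apply/existsP; apply: contraNT z0 => /existsPn Y0.
  rewrite zE enum_rankK_in // big1 // => l _.
  by have := Y0 l; rewrite negbK => /eqP ->; rewrite mulr0.
case/eqP: qz; rewrite rmorph_prod (bigD1 l) //=.
rewrite (qP l (fun v l => match v with inl i => X i l | inr j => Y l j end)) //.
by rewrite mul0r.
Qed.

End GenericRank.

(** * The bound on typical ranks *)

(* Truncated subtraction only matters for r = 0, i.e. for the edgeless graph,
   whose maximum typical rank is 0. *)
Theorem theorem4p6 (R : realType) (m n : nat) (E : {set 'I_m * 'I_n})
    (r s : nat) :
  generic_completion_rank R E r ->
  maximum_typical_rank R E s ->
  (s <= 2 * r - 1)%N.
Proof.
move=> /generic_rank_degenerate degen [[M M_int] _].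
have [A AM _] := (interior_subset M_int).1.
have [eps /= eps0 near_M] := (nbhs_ballP _ _).1 M_int.
(* Any completion of M serves to extend M to a weight on all pairs of vertices. *)
pose w (u v : 'I_m + 'I_n) := match u, v with
  | inl i, inr j | inr j, inl i => A i j
  | _, _ => 0
  end.
have wC u v : w u v = w v u by case: u v => [i|j] [i'|j'].
have [p pw] := degenerate_approximation (@edge_relC _ _ E) (@edge_relI _ _ E)
  wC eps0 degen.
pose A' := (\matrix_i p (inl i)) *m (\matrix_j p (inr j))^T.
have A'E i j : A' i j = dot (p (inl i)) (p (inr j)).
  by rewrite /A' !mxE dotE; apply: eq_bigr => l _; rewrite !mxE.
have [|_ le_s] := near_M (\row_c A' (enum_val c).1 (enum_val c).2).
  split=> // i c; rewrite ord1 mxE -AM /ball /= distrC A'E.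
  by apply: (pw (inl _) (inr _)); rewrite /= -surjective_pairing enum_valP.
apply: leq_trans (le_s A' _) _ => [c|]; first by rewrite [RHS]mxE.
exact: leq_trans (mxrankM_maxl _ _) (rank_leq_col _).
Qed.
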